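(* Let $\Omega$ be a bounded open subset of $\mathbb{R}^n$, let $\mathbf{X}$ be a continuous random vector with values in $\Omega$ and probability density function $f_{\mathbf{X}}$, let $Y=g(\mathbf{X})$ with $g\in C^1(\overline{\Omega},\mathbb{R})$, and let $d\ge 0$. Then $$\mathrm{PEACE}_d(\mathbf{X}\to Y)=\int_{\Omega}|\nabla g(\mathbf{x})|\,f_{\mathbf{X}}^{2d}(\mathbf{x})\,\mathrm{d}\mathbf{x}.$$
   Context: $|\cdot|$ is the Euclidean norm on $\mathbb{R}^n$. $C^1(\overline{\Omega},\mathbb{R})$ is the set of functions $\overline{\Omega}\to\mathbb{R}$ whose first-order derivatives exist and are continuous. $C_c^1(\Omega,\mathbb{R}^n)$ is the set of compactly supported continuously differentiable functions $\Omega\to\mathbb{R}^n$, and $\mathrm{div}(\varphi)=\sum_{i=1}^n\partial\varphi_i/\partial x_i$. Definition: for $Y=g(\mathbf{X})$, $$\mathrm{PEACE}_d(\mathbf{X}\to Y):=\sup\left\{\int_{\Omega} g\,\mathrm{div}(\varphi)\,\mathrm{d}\mathbf{x}:\ \varphi\in C_c^1(\Omega,\mathbb{R}^n),\ |\varphi|\le f_{\mathbf{X}}^{2d}\right\}.$$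
   Formalization: For d > 0 the density f_X is also assumed lower semicontinuous at almost every point of Ω (e.g. a.e. continuous); without this the formula fails, e.g. for g(x) = x and f_X the normalized indicator of a fat Cantor set, where PEACE_d = 0 but the integral is positive. *)

(* Defs.v *)
From HB Require Import structures.
From mathcomp Require Import all_boot all_order all_algebra.
From mathcomp Require Import all_classical all_reals all_analysis.

Set Implicit Arguments.
Unset Strict Implicit.
Unset Printing Implicit Defensive.

Import Order.TTheory GRing.Theory Num.Theory.
Import numFieldNormedType.Exports.

Local Open Scope classical_set_scope.
Local Open Scope ring_scope.

(* [R^n] is ['rV[R]_n].  The library gives it the product topology (through the
   sup norm) but neither a sigma-algebra nor a Lebesgue measure; they are built
   here, following the construction of [n.-tuple T]. *)

Definition measure_rV_display : measure_display -> measure_display.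
Proof. exact. Qed.

Section measurable_rV.
Context {d} {T : measurableType d}.
Variable n : nat.

Let coors : 'I_n -> 'rV[T]_n -> T := fun i v => v ord0 i.

Let rV_set0 : g_sigma_preimage coors set0.
Proof. exact: sigma_algebra0. Qed.

Let rV_setC A : g_sigma_preimage coors A -> g_sigma_preimage coors (~` A).
Proof. exact: sigma_algebraC. Qed.

Let rV_bigcup (F : _^nat) : (forall i, g_sigma_preimage coors (F i)) ->
  g_sigma_preimage coors (\bigcup_i (F i)).
Proof. exact: sigma_algebra_bigcup. Qed.

HB.instance Definition _ := @isMeasurable.Build (measure_rV_display d)
  'rV[T]_n (g_sigma_preimage coors) rV_set0 rV_setC rV_bigcup.

End measurable_rV.

Lemma measurable_coord d (T : measurableType d) n (i : 'I_n) :
  measurable_fun [set: 'rV[T]_n] (fun v => v ord0 i).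
Proof.
move=> _ Y mY; rewrite setTI; apply: sub_sigma_algebra => /=.
rewrite -bigcup_seq/=; exists i => /=; first by rewrite mem_index_enum.
by exists Y => //; rewrite setTI.
Qed.

Lemma measurable_fun_rVP d1 d2 (T1 : measurableType d1)
    (T2 : measurableType d2) n (f : T1 -> 'rV[T2]_n) :
  measurable_fun [set: T1] f <->
  forall i, measurable_fun [set: T1] (fun x => f x ord0 i).
Proof.
split=> [mf i|mf].
  exact: (measurableT_comp (@measurable_coord _ T2 n i) mf).
move=> _ A; rewrite setTI => mA.
suff : g_sigma_preimage (fun i (v : 'rV[T2]_n) => v ord0 i) `<=`
    [set A | measurable (f @^-1` A)] by exact.
apply: smallest_sub.
  split=> /=.
  - by rewrite preimage_set0.
  - by move=> B mB; rewrite setTD -preimage_setC; exact: measurableC.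
  - by move=> F mF; rewrite preimage_bigcup; exact: bigcup_measurable.
rewrite -bigcup_seq; apply: bigcup_sub => i _ _ [B mB <-] /=.
by rewrite setTI -[X in measurable X]setTI; exact: mf.
Qed.

Lemma sigma_finite_product d1 d2 (T1 : measurableType d1)
    (T2 : measurableType d2) (R : realType)
    (m1 : {sigma_finite_measure set T1 -> \bar R})
    (m2 : {sigma_finite_measure set T2 -> \bar R}) :
  sigma_finite setT (m1 \x m2)%E.
Proof.
have /sigma_finiteP[F [TF ndF Foo]] := sigma_finiteT m1.
have /sigma_finiteP[G [TG ndG Goo]] := sigma_finiteT m2.
exists (fun n => F n `*` G n).
  rewrite -setXTT TF TG predeqE => -[x y]; split.
    move=> [/= [n _ Fnx] [k _ Gky]]; exists (maxn n k) => //; split.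
    - by move: x Fnx; exact/subsetPset/ndF/leq_maxl.
    - by move: y Gky; exact/subsetPset/ndG/leq_maxr.
  by move=> [n _ []/= ? ?]; split; exists n.
move=> k; have [? ?] := Foo k; have [? ?] := Goo k.
split; first exact: measurableX.
by rewrite product_measure1E// lte_mul_pinfty// ge0_fin_numE.
Qed.

Section lebesgue_rV.
Context {R : realType}.
Local Notation mu1 := (@lebesgue_measure R).

Definition rV_cons n (p : measurableTypeR R * 'rV[R]_n) : 'rV[R]_n.+1 :=
  row_mx (p.1)%:M p.2.

Lemma rV_cons0 n p : @rV_cons n p ord0 ord0 = p.1.
Proof.
rewrite /rV_cons mxE; case: splitP => [j _|j /= j0].
  by rewrite (ord1 j) mxE eqxx mulr1n.
by case: j j0.
Qed.

Lemma rV_consS n p (i : 'I_n) : rV_cons p ord0 (lift ord0 i) = p.2 ord0 i.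
Proof.
rewrite /rV_cons mxE; case: splitP => [j|j] /= ij.
  by case: j ij => -[].
by congr (p.2 _ _); apply/val_inj; case: ij.
Qed.

Lemma measurable_rV_cons n : measurable_fun setT (@rV_cons n).
Proof.
apply/measurable_fun_rVP => i.
have [->|[j ->]] : i = ord0 \/ exists j, i = lift ord0 j.
  by have [j ->|->] := unliftP ord0 i; [right; exists j|left].
- under eq_fun do rewrite rV_cons0; exact: measurable_fst.
- under eq_fun do rewrite rV_consS.
  exact: (measurableT_comp (measurable_coord j) measurable_snd).
Qed.

Section step.
Variables (n : nat) (m : {sigma_finite_measure set 'rV[R]_n -> \bar R}).

Definition lebesgue_rV_step : set 'rV[R]_n.+1 -> \bar R :=
  pushforward (mu1 \x m)%E (@rV_cons n).

Let step0 : lebesgue_rV_step set0 = 0%E.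
Proof. by rewrite /lebesgue_rV_step /pushforward preimage_set0 measure0. Qed.

Let step_ge0 A : (0 <= lebesgue_rV_step A)%E.
Proof. exact: (measure_ge0 (mu1 \x m)%E). Qed.

Let step_sigma_additive : semi_sigma_additive lebesgue_rV_step.
Proof.
move=> F mF tF mUF; rewrite /lebesgue_rV_step /pushforward preimage_bigcup.
apply: measure_semi_sigma_additive.
- by move=> k; rewrite -[X in measurable X]setTI; exact: measurable_rV_cons.
- apply/trivIsetP => /= i j _ _ ij; rewrite -preimage_setI.
  by move/trivIsetP : tF => /(_ _ _ _ _ ij) ->//; rewrite preimage_set0.
- by rewrite -preimage_bigcup -[X in measurable X]setTI;
    exact: measurable_rV_cons.
Qed.

HB.instance Definition _ := isMeasure.Build _ _ _ lebesgue_rV_step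
  step0 step_ge0 step_sigma_additive.

Let step_sigma_finite : sigma_finite setT lebesgue_rV_step.
Proof.
have [F TF Foo] := sigma_finite_product mu1 m.
pose uncons (v : 'rV[R]_n.+1) : measurableTypeR R * 'rV[R]_n :=
  (v ord0 ord0, \row_i v ord0 (lift ord0 i)).
have consK : cancel (@rV_cons n) uncons.
  move=> p; rewrite /uncons rV_cons0 [RHS]surjective_pairing; congr pair.
  by apply/rowP => i; rewrite mxE rV_consS.
have muncons : measurable_fun setT uncons.
  apply/measurable_fun_pairP; split; first exact: measurable_coord.
  apply/measurable_fun_rVP => i; rewrite /uncons/=.
  under eq_fun do rewrite mxE.
  exact: measurable_coord.
exists (fun k => uncons @^-1` F k); first by rewrite -preimage_bigcup -TF.
move=> k; have [mFk Fkoo] := Foo k; split.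
  by rewrite -[X in measurable X]setTI; exact: muncons.
rewrite /lebesgue_rV_step /pushforward -comp_preimage.
by rewrite (_ : uncons \o _ = id)//; apply/funext => p; exact: consK.
Qed.

HB.instance Definition _ := Measure_isSigmaFinite.Build _ _ _
  lebesgue_rV_step step_sigma_finite.

End step.

(* [R^0] is a point of mass 1. *)
Fixpoint lebesgue_rV (n : nat) : {sigma_finite_measure set 'rV[R]_n -> \bar R} :=
  if n is m.+1 then lebesgue_rV_step (lebesgue_rV m)
  else dirac (0 : 'rV[R]_0).

Lemma lebesgue_rV_box n (A : 'I_n -> set (measurableTypeR R)) :
  (forall i, measurable (A i)) ->
  lebesgue_rV n [set v | forall i, A i (v ord0 i)] = (\prod_(i < n) mu1 (A i))%E.
Proof.
elim: n A => [|n IHn] A mA.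
  rewrite big_ord0 /= diracE mem_set//= => -[].
  by [].
have mB : measurable
    [set v : 'rV[R]_n | forall i, A (lift ord0 i) (v ord0 i)].
  rewrite [X in measurable X](_ : _ = \bigcap_(i in [set: 'I_n])
    (fun v : 'rV[R]_n => v ord0 i) @^-1` A (lift ord0 i)).
    apply: fin_bigcap_measurable => // i _.
    rewrite -[X in measurable X]setTI.
    exact: (measurable_coord i measurableT (mA (lift ord0 i))).
  by apply/seteqP; split => v /= Av i; [move=> _|]; exact: Av.
rewrite big_ord_recl -IHn//= /lebesgue_rV_step /pushforward.
rewrite -product_measure1E//.
congr ((mu1 \x lebesgue_rV n)%E _); apply/seteqP; split => p /=.
  move=> Ap; split; first by have := Ap ord0; rewrite rV_cons0.
  by move=> i; have := Ap (lift ord0 i); rewrite rV_consS.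
move=> [Ap1 Ap2] i; have [j ->|->] := unliftP ord0 i.
  by rewrite rV_consS.
by rewrite rV_cons0.
Qed.

End lebesgue_rV.
Arguments lebesgue_rV R n : clear implicits.

Section euclidean_calculus.
Context {R : realType} {n : nat}.
Implicit Types (D : set 'rV[R]_n) (g : 'rV[R]_n -> R)
  (phi : 'rV[R]_n -> 'rV[R]_n).

(* The library norm [`|v|] on ['rV[R]_n] is the sup norm. *)
Definition enorm (v : 'rV[R]_n) : R := Num.sqrt (\sum_(i < n) v ord0 i ^+ 2).

Definition partial (i : 'I_n) g (x : 'rV[R]_n) : R :=
  'D_(delta_mx ord0 i : 'rV[R]_n) g x.

Definition gradient g (x : 'rV[R]_n) : 'rV[R]_n := \row_i partial i g x.

Definition divergence phi (x : 'rV[R]_n) : R :=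
  \sum_(i < n) partial i (fun y => phi y ord0 i) x.

Definition C1 D g :=
  forall i : 'I_n, forall x, D x ->
    derivable g x (delta_mx ord0 i : 'rV[R]_n) /\ {for x, continuous (partial i g)}.

(* At boundary points of [D] the partial derivatives are understood as the
   continuous extensions of those on [D]; only the values of [g] on
   [closure D] matter. *)
Definition C1_closure D g :=
  [/\ {within closure D, continuous g},
      C1 D g &
      forall i : 'I_n, exists h : 'rV[R]_n -> R,
        {within closure D, continuous h} /\
        (forall x, D x -> h x = partial i g x)].

(* Functions on [D] are represented by total functions whose values outside
   [D] are irrelevant, so the support is taken relatively to [D]. *)
Definition support_in D phi : set 'rV[R]_n :=
  D `&` closure [set x | D x /\ phi x != 0].

Definition C1c D phi :=
  (forall i : 'I_n, C1 D (fun x => phi x ord0 i)) /\ compact (support_in D phi).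

(* The regularity asked of a density, almost everywhere; it holds in particular
   when the density is continuous, or continuous almost everywhere.  For a merely
   measurable density the integral formula fails: if [f] is supported in a
   closed set of positive measure with empty interior and [0 < d], then the only
   [phi] allowed in [PEACE] is 0. *)
Definition lower_semicontinuous_at g (x : 'rV[R]_n) :=
  forall a : R, a < g x -> \forall y \near x, a < g y.

End euclidean_calculus.

Definition has_density d (T : measurableType d) (R : realType) (n : nat)
    (P : probability T R) (X : {RV P >-> 'rV[R]_n}) (f : 'rV[R]_n -> R) :=
  [/\ measurable_fun [set: 'rV[R]_n] f,
      forall x, 0 <= f x &
      forall A : set 'rV[R]_n, measurable A ->
        distribution P X A = (\int[lebesgue_rV R n]_(x in A) (f x)%:E)%E].

(* [PEACE_d (X -> Y)] for [Y = g(X)], as a function of [D], [g] and the density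
   [f] of [X]; it may be infinite.  Since [0 `^ 0 = 1], the weight is constantly
   1 when [d = 0]. *)
Definition PEACE (R : realType) (n : nat) (D : set 'rV[R]_n)
    (f : 'rV[R]_n -> R) (g : 'rV[R]_n -> R) (d : R) : \bar R :=
  ereal_sup [set (\int[lebesgue_rV R n]_(x in D) (g x * divergence phi x)%:E)%E
    | phi in [set phi : 'rV[R]_n -> 'rV[R]_n |
        C1c D phi /\ forall x, D x -> enorm (phi x) <= f x `^ (2 * d)]].

(* Main.v *)
(**
Put [v = - grad g] and [W = f^(2d)].  For an admissible [phi], each product
[g phi_i], extended by zero, is C^1 with compact support in R^n, so the integral
of its [i]-th partial derivative vanishes (Fubini and the fundamental theorem of
calculus on lines).  Hence the integral of [g div phi] is that of [v . phi],
which Cauchy-Schwarz bounds by the integral of [|v| W].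

Conversely, take a C^1 partition of unity with supports in small balls [B_z] and
let [phi] be the sum of the [Psi_z w_z u_z], where [w_z] is the infimum of [W] on
[B_z] and [u_z] is the direction of [v] at the centre, keeping only the balls
that lie in Omega and on which [u_z . v >= 0].  Then [|phi| <= W] everywhere and
[v . phi >= 0], and as the mesh tends to 0, [v . phi] tends to [|v| W] wherever
[W] is lower semicontinuous, that is almost everywhere.  Fatou's lemma concludes.
*)
Require Import Defs.
From HB Require Import structures.
From mathcomp Require Import all_boot all_order all_algebra.
From mathcomp Require Import all_classical all_reals all_analysis.
From mathcomp Require Import measurable_realfun.
From mathcomp Require Import ring lra.

Import Order.TTheory GRing.Theory Num.Theory.
Import numFieldNormedType.Exports.

Local Open Scope classical_set_scope.
Local Open Scope ring_scope.

Set Implicit Arguments.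
Unset Strict Implicit.
Unset Printing Implicit Defensive.

(** * Borel sets, bounded sets and integrability in ['rV[R]_n] *)

Section borel.
Context {R : realType} {n : nat}.
Implicit Types (D K : set 'rV[R]_n) (x : 'rV[R]_n) (F : 'rV[R]_n -> R).

Lemma ball_rVP x (r : R) : 0 < r ->
  ball x r = [set y | forall i, `|x ord0 i - y ord0 i| < r].
Proof.
move=> r0; apply/seteqP; split=> [y [_ xy] i|y /= xy]; first exact: xy.
by split=> // i j; rewrite (ord1 i); exact: xy.
Qed.

Lemma measurable_box (A : 'I_n -> set (measurableTypeR R)) :
  (forall i, measurable (A i)) ->
  measurable [set v : 'rV[R]_n | forall i, A i (v ord0 i)].
Proof.
move=> mA; rewrite [X in measurable X](_ : _ = \bigcap_(i in [set: 'I_n])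
    (fun v : 'rV[R]_n => v ord0 i) @^-1` A i).
  apply: fin_bigcap_measurable => // i _; rewrite -[X in measurable X]setTI.
  exact: (measurable_coord i measurableT (mA i)).
by apply/seteqP; split => v /= Av i; [move=> _|]; exact: Av.
Qed.

Lemma measurable_ball_rV x (r : R) : 0 < r -> measurable (ball x r : set 'rV[R]_n).
Proof.
move=> r0; rewrite ball_rVP//.
apply: (@measurable_box (fun i => [set t : R | `|x ord0 i - t| < r])) => i.
by have := measurable_ball (x ord0 i) r; rewrite -ball_normE.
Qed.

(** Sup-norm balls are boxes, hence measurable, and an open set is the union of the balls it
    contains that have a rational centre and radius [k.+1%:R^-1]: a countable family. *)
Lemma open_measurable_rV D : open D -> measurable D.
Proof.
move=> oD.
pose q2r (p : 'rV[rat]_n) : 'rV[R]_n := map_mx ratr p.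
pose good := [set p : 'rV[rat]_n * nat | ball (q2r p.1) p.2.+1%:R^-1 `<=` D].
have inv0 (k : nat) : 0 < k.+1%:R^-1 :> R by rewrite invr_gt0.
have -> : D = \bigcup_(p : 'rV[rat]_n * nat)
    (if pselect (good p) then ball (q2r p.1) p.2.+1%:R^-1 else set0).
  apply/seteqP; split=> [x Dx|x [p _]]; last by case: pselect => // gp; exact: gp.
  have [/= e e0 eD] := (nbhs_ballP x D).1 (open_nbhs_nbhs (conj oD Dx)).
  (* The radius is below [e / 2], so a ball of this radius that contains [x] lies in [ball x e]. *)
  have [k _] := near_infty_natSinv_lt (PosNum (divr_gt0 e0 (ltr0Sn R 1))).
  move=> /(_ k (leqnn k))/= ke.
  have /choice[q hq] : forall i : 'I_n, exists q : rat,
      `|ratr q - x ord0 i| < k.+1%:R^-1.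
    move=> i; have /rat_in_itvoo[q] : x ord0 i < x ord0 i + k.+1%:R^-1.
      by rewrite ltrDl.
    rewrite in_itv/= => /andP[q1 q2]; exists q.
    by rewrite gtr0_norm ?subr_gt0// ltrBlDl.
  have xq : ball (q2r (\row_i q i)) k.+1%:R^-1 x.
    by rewrite ball_rVP// => i; rewrite !mxE; exact: hq.
  have gp : good (\row_i q i, k).
    move=> y /= yq; apply: eD.
    by apply: (@ball_splitr _ _ (q2r (\row_i q i))); apply: le_ball (ltW ke) _ _.
  by exists (\row_i q i, k) => //; case: pselect.
apply: countable_bigcupT_measurable => [|p]; first exact: countableP.
by case: pselect => /= _; [exact: measurable_ball_rV|exact: measurable0].
Qed.

Lemma compact_measurable_rV K : compact K -> measurable K.
Proof.
move=> cK; have {}cK : closed K by apply: compact_closed => //; exact: norm_hausdorff.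
rewrite -[K]setCK.
by apply: measurableC; apply: open_measurable_rV; exact: closed_openC.
Qed.


Lemma coord_le_norm x i : `|x ord0 i| <= `|x|.
Proof.
rewrite [leRHS]mx_normrE; exact: (@le_bigmax _ _ _ 0 (fun ij => `|x ij.1 ij.2|) (ord0, i)).
Qed.

Lemma lebesgue_rV_bounded D : measurable D -> bounded_set D ->
  (lebesgue_rV R n D < +oo)%E.
Proof.
(* [bounded_set] yields a bound only from numbers strictly above [M], whose sign is unknown; adding
   1 to the absolute value of [M] gives one that is also positive. The set then lies in a cube of
   side [2 * N]. *)
move=> mD [M [_ /(_ (`|M| + 1))MD]].
have {}MD : forall x, D x -> `|x| <= `|M| + 1.
  by apply: MD; rewrite (le_lt_trans (ler_norm M))// ltrDl.
set N := `|M| + 1 in MD.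
pose A (i : 'I_n) : set (measurableTypeR R) := `[- N, N]%classic.
apply: (@le_lt_trans _ _ (lebesgue_rV R n [set v | forall i, A i (v ord0 i)])).
  apply: le_measure; rewrite ?inE//.
    by apply: measurable_box => i; exact: measurable_itv.
  move=> x /MD xN i; rewrite /A/= in_itv/= -ler_norml; apply: le_trans xN.
  exact: coord_le_norm.
rewrite lebesgue_rV_box => [|i]; last exact: measurable_itv.
have N0 : 0 < N by rewrite ltr_wpDl.
rewrite (eq_bigr (fun=> (N - - N)%:E)); last first.
  move=> i _; rewrite /A lebesgue_measure_itv/= lte_fin ifT//.
  by rewrite (lt_trans _ N0)// oppr_lt0.
by rewrite prodEFin ltry.
Qed.

Lemma continuous_measurable_rV D F : open D -> (forall x, D x -> {for x, continuous F}) ->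
  measurable_fun D F.
Proof.
move=> oD cF; apply: (measurability (@RGenOInfty.G R)).
  exact: RGenOInfty.measurableE.
move=> _ [_ [a ->] <-]; apply: open_measurable_rV.
apply: (continuous_inP F oD).1; last exact: interval_open.
by move=> x /set_mem /cF.
Qed.

(** [F] is bounded on [K] by compactness and vanishes on the rest of [D], so a multiple of the
    indicator of [K], a set of finite measure, dominates it. *)
Lemma integrable_compact_support D K F : open D -> compact K -> K `<=` D ->
  (forall x, D x -> {for x, continuous F}) -> (forall x, D x -> ~ K x -> F x = 0) ->
  (lebesgue_rV R n).-integrable D (EFin \o F).
Proof.
move=> oD cK KD cF F0.
have mD := open_measurable_rV oD.
have mK := compact_measurable_rV cK.
have [M FM] : exists M, forall x, K x -> `|F x| <= M.
  have : compact (F @` K).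
    apply: continuous_compact => //; apply: continuous_in_subspaceT => x.
    by move=> /set_mem /KD /cF.
  move=> /compact_bounded[M [_ /(_ (`|M| + 1))MD]]; exists (`|M| + 1) => x Kx.
  by apply: MD; [rewrite (le_lt_trans (ler_norm M))// ltrDl|exists x].
apply: (@le_integrable _ _ _ (lebesgue_rV R n) D mD _ (fun x => (M * \1_K x)%:E)).
- by apply/measurable_EFinP; exact: continuous_measurable_rV.
- move=> x Dx; rewrite /= lee_fin indicE.
  have [/set_mem Kx|/negP Kx] := boolP (x \in K).
    by rewrite mulr1 (le_trans (FM _ Kx))// ler_norm.
  by rewrite F0 ?normr0// => /mem_set.
- under eq_fun do rewrite EFinM.
  apply: integrableZl => //; apply/integrableP; split.
    by apply/measurable_EFinP; exact: measurable_indic.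
  under eq_integral do rewrite gee0_abs ?lee_fin//.
  rewrite integral_indic//; apply: lebesgue_rV_bounded.
    exact: measurableI.
  have [N [Nr NK]] := compact_bounded cK.
  by exists N; split=> // t /NK NKt x [/NKt].
Qed.

End borel.

(** * Directional derivatives, and continuity of C^1 functions *)

Section directional_derivatives.
Context {R : realType}.

Section transport.
Variables (V V' : normedModType R) (F : V -> R) (G : V' -> R).
Variables (x v : V) (y w : V').
Hypothesis FG : forall h : R, F (h *: v + x) = G (h *: w + y).

Let growth_rateE : (fun h : R => h^-1 *: ((F \o shift x) (h *: v) - F x)) =
  (fun h => h^-1 *: ((G \o shift y) (h *: w) - G y)).
Proof.
have FGxy : F x = G y by have := FG 0; rewrite !scale0r !add0r.
by apply/funext => h /=; rewrite FG FGxy.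
Qed.

(** The difference quotients are the same function of [h]. This is how a partial derivative in R^n
    becomes a derivative in fewer variables, and conversely. *)
Lemma derivable_transport : derivable F x v -> derivable G y w.
Proof. by rewrite /derivable growth_rateE. Qed.

Lemma derive_transport : 'D_v F x = 'D_w G y.
Proof. by rewrite /derive growth_rateE. Qed.

End transport.

(** Mean value theorem for the restriction of [F] to the line through [u] directed by [e]. *)
Lemma line_lipschitz (V : normedModType R) (F : V -> R) (u e : V) (C d : R) :
  (forall t : R, `|t| <= `|d| ->
    derivable F (t *: e + u) e /\ `|'D_e F (t *: e + u)| <= C) ->
  `|F (d *: e + u) - F u| <= C * `|d|.
Proof.
move=> dF; pose f (t : R) := F (t *: e + u).
have fE (t h : R) : F (h *: e + (t *: e + u)) = f (h *: (1 : R^o) + t).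
  by rewrite /f scalerDl addrA scaler1.
have df (t : R) : `|t| <= `|d| -> is_derive t 1 f ('D_e F (t *: e + u)).
  move=> /dF[dFt _]; split; first exact: (derivable_transport (fE t) dFt).
  by rewrite -(derive_transport (fE t)).
(* The mean value theorem wants ordered endpoints: [H] is used on [0, d] or on [d, 0] according to
   the sign of [d]. *)
suff H (a b : R) : a <= b -> `|a| <= `|d| -> `|b| <= `|d| -> `|f b - f a| <= C * (b - a).
  rewrite -[F u](_ : f 0 = _); last by rewrite /f scale0r add0r.
  have [d0|/ltW d0] := leP 0 d.
    by have := H 0 d d0; rewrite normr0 subr0 (ger0_norm d0); apply.
  have := H d 0 d0; rewrite normr0 distrC sub0r (ler0_norm d0); apply=> //.
  by rewrite oppr_ge0.
move=> ab ad bd.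
have abd t : t \in `[a, b]%R -> `|t| <= `|d|.
  rewrite in_itv/= => /andP[a_t tb]; rewrite ler_norml.
  move: ad bd; rewrite !ler_norml => /andP[da _] /andP[_ bd].
  by rewrite (le_trans da)//= (le_trans tb).
have [t tab|t|c cab ->] := MVT_segment (f := f) (df := fun t => 'D_e F (t *: e + u)) ab.
- by apply: df; apply: abd; exact: subset_itv_oo_cc tab.
- apply: continuous_in_subspaceT => s /set_mem sab.
  apply: differentiable_continuous; apply/derivable1_diffP.
  by have /df[] := abd _ sab.
- rewrite normrM (ger0_norm (_ : 0 <= b - a)) ?subr_ge0//.
  by rewrite ler_wpM2r ?subr_ge0//; apply: (dF c _).2; exact: abd.
Qed.

(** [C1] speaks of partial derivatives only. These are bounded near [x], so going from [x] to [y]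
    one coordinate at a time shows that [F] is Lipschitz at [x]. *)
Lemma C1_continuous n (D : set 'rV[R]_n) (F : 'rV[R]_n -> R) :
  open D -> C1 D F -> forall x, D x -> {for x, continuous F}.
Proof.
move=> oD dF x Dx; pose C := \sum_(i < n) `|partial i F x| + 1.
have C0 : 0 <= C by rewrite addr_ge0// sumr_ge0.
have : \forall y \near x, D y /\ forall i, `|partial i F y| <= C.
  near=> y; split; first by near: y; apply: open_nbhs_nbhs.
  near: y; apply: filter_forall => i.
  have [_ /cvgr_dist_le /(_ 1 ltr01)] := dF i x Dx; apply: filterS => y.
  rewrite distrC => dxy; rewrite -[partial i F y](subrK (partial i F x)).
  rewrite (le_trans (ler_normD _ _))// addrC lerD// (bigD1 i)//= lerDl.
  exact: sumr_ge0.
move=> /nbhs_ballP[r /= r0 rD].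
have step y : ball x r y -> `|F y - F x| <= n%:R * C * `|y - x|.
  (* [w k] has the first [k] coordinates of [y] and the others of [x]. The segments between
     consecutive [w k] stay in [ball x r], because that ball is a box. *)
  move=> xy; pose w k : 'rV[R]_n := \row_i (if (i < k)%N then y ord0 i else x ord0 i).
  have w_ball (z : 'rV[R]_n) : (forall i, `|z ord0 i - x ord0 i| <= `|y ord0 i - x ord0 i|) ->
     ball x r z.
    move=> zy; rewrite ball_rVP// => i; rewrite distrC (le_lt_trans (zy i))//.
    by rewrite distrC; move: xy; rewrite ball_rVP//; exact.
  have -> : F y - F x = \sum_(0 <= k < n) (F (w k.+1) - F (w k)).
    rewrite telescope_sumr//; congr (F _ - F _); apply/rowP => i; rewrite mxE//.
    by rewrite ltn_ord.
  rewrite big_mkord (le_trans (ler_norm_sum _ _ _))//.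
  rewrite -mulrA -[n in n%:R]card_ord -sum1_card natr_sum mulr_suml.
  apply: ler_sum => k _; rewrite mul1r.
  have -> : w k.+1 = (y ord0 k - x ord0 k) *: delta_mx ord0 k + w k.
    apply/rowP => i; rewrite !mxE eqxx/= ltnS leq_eqVlt (inj_eq val_inj).
    have [->|ik] := eqVneq i k; first by rewrite ltnn mulr1 subrK.
    by rewrite mulr0 add0r.
  apply: (@le_trans _ _ (C * `|y ord0 k - x ord0 k|)).
    apply: line_lipschitz => t ty.
    have /rD[Dz dFz] : ball x r (t *: delta_mx ord0 k + w k).
      apply: w_ball => i; rewrite !mxE eqxx/=.
      have [->|ik] := eqVneq i k; first by rewrite ltnn mulr1 addrK.
      by rewrite mulr0 add0r; case: ifP => // _; rewrite subrr normr0.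
    by split; [exact: (dF k _ Dz).1|exact: dFz].
  rewrite ler_wpM2l//.
  by have := coord_le_norm (y - x) k; rewrite !mxE.
have nC0 : 0 < n%:R * C + 1.
  by rewrite ltr_wpDl// mulr_ge0.
apply: (cvgrPdist_le (FF := nbhs_filter x) F (F x)).2 => e e0.
have : nbhs x (ball x r `&` ball x (e / (n%:R * C + 1))).
  by apply: filterI; apply: nbhsx_ballx => //; rewrite divr_gt0.
apply: filterS => y [xy yx]; rewrite distrC (le_trans (step _ xy))//.
move: yx; rewrite -ball_normE/= distrC => /ltW yx.
apply: (@le_trans _ _ ((n%:R * C + 1) * `|y - x|)).
  by rewrite ler_wpM2r// lerDl.
by rewrite mulrC -ler_pdivlMr.
Unshelve. all: by end_near. Qed.

End directional_derivatives.

(** * The integral of a compactly supported partial derivative *)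

Section integral_partial.
Context {R : realType}.

Lemma cvg_rV (T : Type) (F : set_system T) (FF : Filter F) n
    (f : T -> 'rV[R]_n) (v : 'rV[R]_n) :
  (forall i, (fun t => f t ord0 i) @ F --> v ord0 i) -> f @ F --> v.
Proof.
move=> fv; apply: (cvgrPdist_lt (FF := FF) f v).2 => e e0.
have : \forall t \near F, forall i, `|v ord0 i - f t ord0 i| < e.
  by apply: filter_forall => i; exact: (cvgrPdist_lt (FF := FF) _ _).1 (fv i) e e0.
apply: filterS => t ft.
have : ball v e (f t) by rewrite ball_rVP.
by rewrite -ball_normE.
Qed.

(** This lemma and [rV_cons_shiftS] put coordinate lines in the form that [derivable_transport]
    expects. *)
Lemma rV_cons_shift0 n (t s : R) (y : 'rV[R]_n) :
  s *: delta_mx ord0 ord0 + rV_cons (t, y) = rV_cons (s + t, y).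
Proof.
apply/rowP => i; rewrite mxE [X in X + _]mxE [X in _ * X + _]mxE eqxx/=.
case: (unliftP ord0 i) => [j ->|->].
  by rewrite !rV_consS eq_sym (negbTE (neq_lift _ _)) mulr0 add0r.
by rewrite !rV_cons0 eqxx mulr1.
Qed.

Lemma rV_cons_shiftS n (j : 'I_n) (t s : R) (y : 'rV[R]_n) :
  s *: delta_mx ord0 (lift ord0 j) + rV_cons (t, y) =
  rV_cons (t, s *: delta_mx ord0 j + y).
Proof.
apply/rowP => i; rewrite mxE [X in X + _]mxE [X in _ * X + _]mxE eqxx/=.
case: (unliftP ord0 i) => [k ->|->].
  by rewrite !rV_consS !mxE eqxx/= (inj_eq lift_inj).
by rewrite !rV_cons0 (negbTE (neq_lift _ _)) mulr0 add0r.
Qed.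

Lemma rV_cons_continuousl n (y : 'rV[R]_n) :
  continuous (fun t : R => rV_cons (t, y)).
Proof.
move=> t; apply: cvg_rV => i; case: (unliftP ord0 i) => [j ->|->].
  under eq_fun do rewrite rV_consS; rewrite rV_consS; exact: cvg_cst.
by under eq_fun do rewrite rV_cons0; rewrite rV_cons0; exact: cvg_id.
Qed.

Lemma rV_cons_continuousr n (t : R) :
  continuous (fun y : 'rV[R]_n => rV_cons (t, y)).
Proof.
move=> y; apply: (@cvg_rV _ _ (nbhs_filter y)) => i; case: (unliftP ord0 i) => [j ->|->].
  under eq_fun do rewrite rV_consS; rewrite rV_consS; exact: coord_continuous.
by under eq_fun do rewrite rV_cons0; rewrite rV_cons0; exact: (@cvg_cst _ _ _ _ (nbhs_filter y)).
Qed.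

Lemma derive_near0 (V : normedModType R) (F : V -> R) x v :
  (\forall y \near x, F y = 0) -> derivable F x v /\ 'D_v F x = 0.
Proof.
move=> F0; have F0' : \forall y \near x, cst 0 y = F y.
  by apply: filterS F0 => y ->.
split; first by apply: near_eq_derivable F0' _; exact: derivable_cst.
by rewrite -(near_eq_derive v F0') derive_cst.
Qed.

(** The condition on [x] is open, so [h] vanishes on a neighbourhood of [x]. *)
Lemma partial_eq0_outside n (i : 'I_n) (h : 'rV[R]_n -> R) (M : R) (x : 'rV[R]_n) :
  (forall y : 'rV[R]_n, (exists j, M < `|y ord0 j|) -> h y = 0) ->
  (exists j, M < `|x ord0 j|) -> partial i h x = 0.
Proof.
move=> h0 [j Mxj]; apply: (derive_near0 _ _).2.
have : \forall y \near x, M < `|(y : 'rV[R]_n) ord0 j|.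
  apply: (@cvgr_gt R _ _ (nbhs_filter x) (fun y : 'rV[R]_n => `|y ord0 j|) `|x ord0 j|) => //.
  by apply: cvg_norm; exact: coord_continuous.
by apply: filterS => y My; apply: h0; exists j.
Qed.

(** Fundamental theorem of calculus on an interval [[- N, N]] outside which [F] and its derivative
    vanish, and at whose ends [F] vanishes too. *)
Lemma integral_derive_eq0 (F : R -> R) (M : R) :
  (forall t, derivable F t 1) -> continuous (fun t => 'D_1 F t) ->
  (forall t, M < `|t| -> F t = 0) ->
  (\int[lebesgue_measure]_t ('D_1 F t)%:E = 0)%E.
Proof.
move=> dF cF F0; pose N := `|M| + 1.
have MN (t : R) : N <= `|t| -> M < `|t|.
  by apply: lt_le_trans; rewrite (le_lt_trans (ler_norm M))// ltrDl.
have N0 : 0 < N by rewrite ltr_wpDl.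
have dF0 t : M < `|t| -> 'D_1 F t = 0.
  move=> Mt; apply: (derive_near0 _ _).2.
  have : \forall y \near t, M < `|y|.
    by apply: (@cvgr_gt R _ _ (nbhs_filter t) (fun y : R => `|y|) `|t|) => //; exact: cvg_norm.
  by apply: filterS => y /F0.
have FN t : `|t| = N -> F t = 0 by move=> tN; rewrite F0// MN// tN.
rewrite [LHS](_ : _ = \int[lebesgue_measure]_(t in `[(- N)%R, N]) ('D_1 F t)%:E)%E; last first.
  rewrite [RHS]integral_mkcond; apply: eq_integral => t _; rewrite patchE.
  case: ifPn => // /negP tN; rewrite dF0//; apply: MN; apply: ltW; rewrite ltNge.
  by apply/negP => Nt; apply: tN; rewrite inE/= in_itv/= -ler_norml.
rewrite (@continuous_FTC2 _ _ F)//.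
- by rewrite !FN ?normrN ?gtr0_norm// subee.
- by rewrite (lt_trans _ N0)// oppr_lt0.
- exact: continuous_subspaceT.
- have cF0 : continuous F.
    by move=> t; apply: differentiable_continuous; exact/derivable1_diffP.
  split => //; first exact: cvg_at_right_filter (cF0 _).
  exact: cvg_at_left_filter (cF0 _).
- by move=> t _; rewrite derive1E.
Qed.

(** Induction on the dimension, [lebesgue_rV] being the image of a product measure under [rV_cons].
    Fubini is applied in the order that makes the inner integral contain the differentiated
    coordinate, and this inner integral is already 0. *)
Lemma integral_partial_eq0 n (i : 'I_n) (h : 'rV[R]_n -> R) (M : R) :
  (forall x, derivable h x (delta_mx ord0 i : 'rV[R]_n)) ->
  continuous (partial i h) ->
  (forall x : 'rV[R]_n, (exists j, M < `|x ord0 j|) -> h x = 0) ->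
  (\int[lebesgue_rV R n]_x (partial i h x)%:E = 0)%E.
Proof.
elim: n i h => [[]//|n IHn] i h dh ch h0.
pose F := EFin \o partial i h.
pose A (j : 'I_n.+1) : set R := `[- M, M]%classic.
have iF : (lebesgue_rV R n.+1).-integrable setT F.
  apply: (@integrable_compact_support _ _ setT [set v | forall j, A j (v ord0 j)]) => //.
  - exact: openT.
  - by apply: rV_compact => j; exact: segment_compact.
  - by move=> x _; exact: ch.
  - move=> x _ /existsNP[j]; rewrite /A/= in_itv/= -ler_norml => /negP.
    by rewrite -ltNge => Mx; apply: partial_eq0_outside h0 _; exists j.
have mF : measurable_fun setT F by have /integrableP[] := iF.
pose G := F \o @rV_cons R n.
have mcons := @measurable_rV_cons R n.
have mG : measurable_fun setT G by exact: measurableT_comp.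
have iG : (lebesgue_measure \x lebesgue_rV R n)%E.-integrable setT G.
  apply/integrableP; split => //.
  have /integrableP[_] := iF; apply: le_lt_trans.
  rewrite (ge0_integral_pushforward mcons)//.
  by apply: measurableT_comp.
transitivity (\int[(lebesgue_measure \x lebesgue_rV R n)%E]_p G p)%E.
  exact: (integral_pushforward mcons mF iG measurableT).
(* If [i] is not the first coordinate, the inner integral is over the other [n] coordinates and the
   induction hypothesis applies; otherwise it is over the first one and [integral_derive_eq0]
   applies. *)
have [j ij|i0] := unliftP ord0 i.
  rewrite -integral12_prod_meas1//; apply: integral0_eq => t _.
  have dE y s : h (s *: delta_mx ord0 (lift ord0 j) + rV_cons (t, y)) =
      (fun z => h (rV_cons (t, z))) (s *: delta_mx ord0 j + y).
    by rewrite rV_cons_shiftS.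
  have pE y : partial (lift ord0 j) h (rV_cons (t, y)) =
      partial j (fun z => h (rV_cons (t, z))) y.
    exact: (derive_transport (dE y)).
  rewrite /fubini_F; rewrite (eq_integral (fun y => (partial j (fun z => h (rV_cons (t, z))) y)%:E)).
    2: by move=> y _; rewrite -pE -ij.
  apply: IHn.
  - by move=> y; apply: derivable_transport (dE y) _; rewrite -ij.
  - rewrite (_ : partial j _ = fun y => partial i h (rV_cons (t, y))).
      2: by apply/funext => y; rewrite ij; exact/esym/pE.
    move=> y; apply: (@continuous_comp _ _ _ (fun y => rV_cons (t, y)) (partial i h)).
      exact: rV_cons_continuousr.
    exact: ch.
  - by move=> y [k Mk]; apply: h0; exists (lift ord0 k); rewrite rV_consS.
rewrite -integral21_prod_meas1//; apply: integral0_eq => y _.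
have dE t s : h (s *: delta_mx ord0 ord0 + rV_cons (t, y)) =
    (fun z => h (rV_cons (z, y))) (s *: (1 : R^o) + t).
  by rewrite rV_cons_shift0 scaler1.
have pE t : partial ord0 h (rV_cons (t, y)) = 'D_1 (fun z => h (rV_cons (z, y))) t.
  exact: (derive_transport (dE t)).
transitivity (\int[lebesgue_measure]_t ('D_1 (fun z => h (rV_cons (z, y))) t)%:E)%E.
  by apply: eq_integral => t _; rewrite -pE -i0.
apply: (@integral_derive_eq0 (fun z => h (rV_cons (z, y))) M).
- by move=> t; apply: derivable_transport (dE t) _; rewrite -i0.
- have -> : (fun t : R => 'D_1 (fun z : R => h (rV_cons (z, y))) t) =
      (fun t => partial i h (rV_cons (t, y))).
    by apply/funext => t; rewrite i0; exact/esym/pE.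
  move=> t; apply: (@continuous_comp _ _ _ (fun t => rV_cons (t, y)) (partial i h)).
    exact: rV_cons_continuousl.
  exact: ch.
- by move=> t Mt; apply: h0; exists ord0; rewrite rV_cons0.
Qed.

End integral_partial.

(** * Closure properties of [C1] *)

Section C1_algebra.
Context {R : realType} {n : nat}.
Implicit Types (D K : set 'rV[R]_n) (x : 'rV[R]_n) (F G g : 'rV[R]_n -> R).

Lemma continuous_near_eq (T U : topologicalType) (F G : T -> U) (x : T) :
  (\forall y \near x, F y = G y) -> {for x, continuous G} -> {for x, continuous F}.
Proof.
move=> FG; rewrite /prop_for /continuous_at (nbhs_singleton FG).
by move=> cG; apply: cvg_trans cG; apply: near_eq_cvg; apply: filterS FG => y ->.
Qed.

Lemma continuous_sum (T : topologicalType) (I : Type) (s : seq I) (F : I -> T -> R) (x : T) :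
  (forall i, {for x, continuous (F i)}) ->
  {for x, continuous (fun y => \sum_(i <- s) F i y)}.
Proof.
move=> cF; elim: s => [|i s IHs].
  apply: (@continuous_near_eq _ _ _ (fun=> 0)); last exact: cvg_cst.
  by apply: nearW => y; rewrite big_nil.
apply: (@continuous_near_eq _ _ _ (fun y => F i y + \sum_(j <- s) F j y)).
  by apply: nearW => y; rewrite big_cons.
exact: continuousD (cF i) IHs.
Qed.

Lemma partial_eq_in D F G : open D -> (forall x, D x -> F x = G x) ->
  forall i x, D x -> partial i F x = partial i G x.
Proof.
move=> oD FG i x Dx; apply: near_eq_derive.
by apply: filterS (open_nbhs_nbhs (conj oD Dx)) => y /FG.
Qed.

Lemma C1_eq_in D F G : open D -> (forall x, D x -> F x = G x) -> C1 D G -> C1 D F.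
Proof.
move=> oD FG dG i x Dx; have [dGx cGx] := dG i x Dx.
have nD := open_nbhs_nbhs (conj oD Dx); split.
  by apply: near_eq_derivable dGx; apply: filterS nD => y /FG.
apply: continuous_near_eq cGx; apply: filterS nD => y Dy.
exact: partial_eq_in Dy.
Qed.

Lemma C1_cst D (c : R) : C1 D (fun=> c).
Proof.
move=> i x _; split; first exact: derivable_cst.
have -> : partial i (fun=> c) = fun=> 0.
  by apply/funext => y; rewrite /partial derive_cst.
exact: cst_continuous.
Qed.

Lemma C1D D F G : open D -> C1 D F -> C1 D G -> C1 D (fun x => F x + G x).
Proof.
move=> oD dF dG i x Dx; split; first exact: derivableD (dF i x Dx).1 (dG i x Dx).1.
apply: (@continuous_near_eq _ _ _ (partial i F + partial i G)).
  apply: filterS (open_nbhs_nbhs (conj oD Dx)) => y Dy.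
  exact: deriveD (dF i y Dy).1 (dG i y Dy).1.
exact: continuousD (dF i x Dx).2 (dG i x Dx).2.
Qed.

Lemma partialM i F G x :
  derivable F x (delta_mx ord0 i : 'rV[R]_n) ->
  derivable G x (delta_mx ord0 i : 'rV[R]_n) ->
  partial i (fun y => F y * G y) x = F x * partial i G x + G x * partial i F x.
Proof. exact: deriveM. Qed.

(** The partial derivatives of the product involve [F] and [G] themselves, whose continuity is
    [C1_continuous]. *)
Lemma C1M D F G : open D -> C1 D F -> C1 D G -> C1 D (fun x => F x * G x).
Proof.
move=> oD dF dG i x Dx; split; first exact: derivableM (dF i x Dx).1 (dG i x Dx).1.
apply: (@continuous_near_eq _ _ _
    (fun y => F y * partial i G y + G y * partial i F y)).
  apply: filterS (open_nbhs_nbhs (conj oD Dx)) => y Dy.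
  exact: partialM (dF i y Dy).1 (dG i y Dy).1.
by apply: continuousD; apply: continuousM;
  [exact: C1_continuous oD dF _ Dx|exact: (dG i x Dx).2|
   exact: C1_continuous oD dG _ Dx|exact: (dF i x Dx).2].
Qed.

Lemma C1_sum D (I : Type) (s : seq I) (F : I -> 'rV[R]_n -> R) : open D ->
  (forall k, C1 D (F k)) -> C1 D (fun x => \sum_(k <- s) F k x).
Proof.
move=> oD dF; elim: s => [|k s IHs].
  by under eq_fun do rewrite big_nil; exact: C1_cst.
by under eq_fun do rewrite big_cons; exact: C1D.
Qed.

Lemma C1_prod D (I : Type) (s : seq I) (F : I -> 'rV[R]_n -> R) : open D ->
  (forall k, C1 D (F k)) -> C1 D (fun x => \prod_(k <- s) F k x).
Proof.
move=> oD dF; elim: s => [|k s IHs].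
  by under eq_fun do rewrite big_nil; exact: C1_cst.
by under eq_fun do rewrite big_cons; exact: C1M.
Qed.

End C1_algebra.

(** * Integration by parts against compactly supported fields *)

Section integration_by_parts.
Context {R : realType} {n : nat}.
Implicit Types (D K : set 'rV[R]_n) (x : 'rV[R]_n) (g : 'rV[R]_n -> R)
  (phi : 'rV[R]_n -> 'rV[R]_n).

Definition dot (u v : 'rV[R]_n) : R := \sum_(i < n) u ord0 i * v ord0 i.

Lemma notin_support_in D phi x : D x -> ~ support_in D phi x -> phi x = 0.
Proof.
move=> Dx Nx; apply/eqP; apply: contrapT => /negP phix; apply: Nx; split => //.
by apply: subset_closure; split.
Qed.

(** The open sets [D] and the complement of [K] cover the space; the extension agrees with [g] on
    the first and with 0 on the second. *)
Lemma C1_extend0 D K g : open D -> compact K -> K `<=` D -> C1 D g ->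
  (forall x, D x -> ~ K x -> g x = 0) -> C1 setT (g \_ D).
Proof.
move=> oD cK KD dg g0 i x _; have [Dx|Dx] := pselect (D x).
  apply: (C1_eq_in oD _ dg) => // y Dy; rewrite patchE mem_set//.
have oK : open (~` K).
  by rewrite openC; apply: compact_closed => //; exact: norm_hausdorff.
apply: (@C1_eq_in _ _ (~` K) _ (fun=> 0)) => //; last 2 first.
- exact: C1_cst.
- by move=> /KD.
move=> y Ky; rewrite patchE; case: ifPn => // /set_mem Dy; exact: g0.
Qed.

Lemma integral_partial_compact_support D K g i : open D -> compact K -> K `<=` D ->
  C1 D g -> (forall x, D x -> ~ K x -> g x = 0) ->
  (\int[lebesgue_rV R n]_(x in D) (partial i g x)%:E = 0)%E.
Proof.
move=> oD cK KD dg g0; have dgD := C1_extend0 oD cK KD dg g0.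
have gD0 x : ~ K x -> (g \_ D) x = 0.
  by move=> Kx; rewrite patchE; case: ifPn => // /set_mem Dx; exact: g0.
have oK : open (~` K).
  by rewrite openC; apply: compact_closed => //; exact: norm_hausdorff.
have [N [_ /(_ (`|N| + 1)) NK]] := compact_bounded cK.
have {}NK : forall x, K x -> `|x| <= `|N| + 1.
  by apply: NK; rewrite (le_lt_trans (ler_norm N))// ltrDl.
rewrite -(@integral_partial_eq0 R n i (g \_ D) (`|N| + 1)).
- rewrite integral_mkcond; apply: eq_integral => x _; rewrite patchE.
  case: ifPn => [/set_mem Dx|/negP Dx].
    by congr EFin; apply: (partial_eq_in oD) => // y Dy; rewrite patchE mem_set.
  rewrite (@partial_eq_in _ _ (~` K) _ (fun=> 0))//.
  - by rewrite /partial derive_cst.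
  - by move=> /KD /mem_set.
- by move=> x; exact: (dgD i x I).1.
- by move=> x; exact: (dgD i x I).2.
- move=> x [j Nj]; apply: gD0 => /NK; apply/negP; rewrite -ltNge.
  exact: lt_le_trans Nj (coord_le_norm x j).
Qed.

(** By the product rule, [g * divergence phi] is the sum of the [partial i (h i)] minus the scalar
    product of the gradient with [phi]. Each [h i] is supported in [K], so its partial derivatives
    integrate to 0. *)
Lemma divergence_by_parts D g phi : open D -> C1 D g -> C1c D phi ->
  (\int[lebesgue_rV R n]_(x in D) (g x * divergence phi x)%:E =
   \int[lebesgue_rV R n]_(x in D) (- dot (gradient g x) (phi x))%:E)%E.
Proof.
move=> oD dg [dphi cK]; set K := support_in D phi in cK.
have KD : K `<=` D by move=> x [].
have phi0 x : D x -> ~ K x -> phi x = 0 by exact: notin_support_in.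
pose h i x := g x * phi x ord0 i.
have dh i : C1 D (h i) by exact: C1M.
have h0 i x : D x -> ~ K x -> h i x = 0.
  by move=> Dx Kx; rewrite /h phi0// mxE mulr0.
have mD := open_measurable_rV oD.
have oK : open (~` K).
  by rewrite openC; apply: compact_closed => //; exact: norm_hausdorff.
(* The derivative of [h i] vanishes off [K] because [h i] does so on the open set of points of [D]
   outside [K]. *)
have ih i : (lebesgue_rV R n).-integrable D (EFin \o partial i (h i)).
  apply: (integrable_compact_support oD cK KD).
    by move=> x Dx; exact: (dh i i x Dx).2.
  move=> x Dx Kx; rewrite (@partial_eq_in _ _ (D `&` ~` K) _ (fun=> 0))//.
  - by rewrite /partial derive_cst.
  - exact: openI.
  - by move=> y [Dy Ky]; exact: h0.
have idot : (lebesgue_rV R n).-integrable D (fun x => (- dot (gradient g x) (phi x))%:E).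
  apply: (integrable_compact_support oD cK KD).
    move=> x Dx; apply: continuousN; apply: continuous_sum => i; apply: continuousM.
      rewrite (_ : (fun y => _) = partial i g); first exact: (dg i x Dx).2.
      by apply/funext => y; rewrite mxE.
    exact: C1_continuous oD (dphi i) _ Dx.
  by move=> x Dx Kx; rewrite /dot big1 ?oppr0// => i _; rewrite phi0// [X in _ * X]mxE mulr0.
transitivity (\int[lebesgue_rV R n]_(x in D)
    ((\sum_(i < n) (partial i (h i) x)%:E) + (- dot (gradient g x) (phi x))%:E))%E.
  apply: eq_integral => x /set_mem Dx; rewrite sumEFin -EFinD; congr EFin.
  rewrite /dot /divergence mulr_sumr -sumrN -big_split/=; apply: eq_bigr => i _.
  rewrite /h partialM ?mxE; [|exact: (dg i x Dx).1|exact: (dphi i i x Dx).1].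
  by rewrite [partial i g x * _]mulrC addrK.
rewrite integralD//; last by apply: integrable_sum => // i _; exact: ih.
rewrite integral_sum// big1 ?add0e// => i _.
exact: integral_partial_compact_support oD cK KD (dh i) (h0 i).
Qed.

End integration_by_parts.

(** * The Euclidean scalar product and norm *)

Section euclidean_norm.
Context {R : realType} {n : nat}.
Implicit Types u v : 'rV[R]_n.

Lemma enorm_ge0 u : 0 <= enorm u.
Proof. exact: sqrtr_ge0. Qed.

Lemma dot_sq u : dot u u = enorm u ^+ 2.
Proof.
rewrite sqr_sqrtr; last by apply: sumr_ge0 => i _; exact: sqr_ge0.
by apply: eq_bigr => i _; rewrite expr2.
Qed.

Lemma dotC u v : dot u v = dot v u.
Proof. by apply: eq_bigr => i _; rewrite mulrC. Qed.

Lemma dotDr u v w : dot u (v + w) = dot u v + dot u w.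
Proof. by rewrite -big_split; apply: eq_bigr => i _; rewrite mxE mulrDr. Qed.

Lemma dotDl u v w : dot (u + v) w = dot u w + dot v w.
Proof. by rewrite dotC dotDr !(dotC w). Qed.

Lemma dotZl a u v : dot (a *: u) v = a * dot u v.
Proof. by rewrite /dot mulr_sumr; apply: eq_bigr => i _; rewrite mxE mulrA. Qed.

Lemma dotNl u v : dot (- u) v = - dot u v.
Proof. by rewrite -scaleN1r dotZl mulN1r. Qed.

Lemma dot0l v : dot 0 v = 0.
Proof. by rewrite -(scale0r 0) dotZl mul0r. Qed.

Lemma dot_suml (I : Type) (s : seq I) (F : I -> 'rV[R]_n) v :
  dot (\sum_(i <- s) F i) v = \sum_(i <- s) dot (F i) v.
Proof.
elim: s => [|i s IHs]; first by rewrite !big_nil dot0l.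
by rewrite !big_cons dotDl IHs.
Qed.

Lemma enorm0_eq0 u : enorm u = 0 -> u = 0.
Proof.
move=> u0; have : dot u u = 0 by rewrite dot_sq u0 expr0n.
move/eqP; rewrite psumr_eq0 => [/allP u00|i _]; last by rewrite -expr2 sqr_ge0.
apply/rowP => i; rewrite mxE; apply/eqP.
by have := u00 i (mem_index_enum _); rewrite mulf_eq0 orbb.
Qed.

Lemma enorm0 : enorm (0 : 'rV[R]_n) = 0.
Proof. by rewrite /enorm big1 ?sqrtr0// => i _; rewrite mxE expr0n. Qed.

Lemma enormZ a u : enorm (a *: u) = `|a| * enorm u.
Proof.
rewrite /enorm -sqrtr_sqr -sqrtrM ?sqr_ge0// mulr_sumr; congr Num.sqrt.
by apply: eq_bigr => i _; rewrite mxE exprMn.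
Qed.

Lemma enormN u : enorm (- u) = enorm u.
Proof. by rewrite -scaleN1r enormZ normrN1 mul1r. Qed.

(** Expanding the square of the norm of [w] gives twice [enorm u * enorm v] times the difference of
    the two sides; the factor is positive once zero vectors are set aside. *)
Lemma dot_le u v : dot u v <= enorm u * enorm v.
Proof.
have [/enorm0_eq0 ->|u0] := eqVneq (enorm u) 0; first by rewrite dot0l enorm0 mul0r.
have [/enorm0_eq0 ->|v0] := eqVneq (enorm v) 0.
  by rewrite dotC dot0l enorm0 mulr0.
have uv0 : 0 < enorm u * enorm v by rewrite mulr_gt0// lt_def ?u0 ?v0 enorm_ge0.
set w := enorm v *: u - enorm u *: v.
have : 0 <= dot w w by rewrite dot_sq sqr_ge0.
rewrite {1}/w dotDl dotZl dotNl dotZl !(dotC _ w) /w !(dotDl, dotNl, dotZl) !dot_sq.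
rewrite (dotC v u) => h; rewrite -(ler_pM2l uv0); nra.
Qed.

Lemma enormD u v : enorm (u + v) <= enorm u + enorm v.
Proof.
rewrite -(@ler_pXn2r _ 2) ?nnegrE ?addr_ge0 ?enorm_ge0//.
rewrite -dot_sq dotDl !dotDr !dot_sq (dotC v u).
by have := dot_le u v; nra.
Qed.

Lemma enorm_sum_le (I : Type) (s : seq I) (a : I -> R) (F : I -> 'rV[R]_n) :
  (forall i, 0 <= a i) -> (forall i, enorm (F i) <= 1) ->
  enorm (\sum_(i <- s) a i *: F i) <= \sum_(i <- s) a i.
Proof.
move=> a0 F1; elim: s => [|i s IHs]; first by rewrite !big_nil enorm0.
rewrite !big_cons (le_trans (enormD _ _))// lerD// enormZ ger0_norm//.
by rewrite ler_piMr.
Qed.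

End euclidean_norm.

(** * A C^1 partition of unity on a cube *)

Section partition_of_unity.
Context {R : realType}.

(** The difference quotient is within [C * |h|] of [l]. Such an estimate treats the kink of [max]
    like any other point. *)
Lemma is_derive_quadratic (p : R -> R) (t l C : R) :
  (forall h, `|p (h + t) - p t - h * l| <= C * h ^+ 2) -> is_derive t 1 p l.
Proof.
move=> pC; have pl : h^-1 *: ((p \o shift t) (h *: 1) - p t) @[h --> 0^'] --> l.
  apply/cvgrPdist_le => e e0; near=> h.
  have h0 : h != 0 by near: h; exact: nbhs_dnbhs_neq.
  rewrite distrC /= scaler1.
  have -> : h^-1 *: (p (h + t) - p t) - l = h^-1 * (p (h + t) - p t - h * l).
    by rewrite mulrBr mulrA mulVf// mul1r.
  rewrite normrM normfV mulrC ler_pdivrMr ?normr_gt0//.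
  rewrite (le_trans (pC h))// -[h ^+ 2]real_normK ?num_real// expr2 mulrA.
  rewrite ler_wpM2r//.
  have : `|h| < e / (`|C| + 1).
    near: h; apply: dnbhs0_lt; rewrite divr_gt0// ltr_wpDl//.
  rewrite ltr_pdivlMr ?ltr_wpDl// => /ltW; apply: le_trans.
  by rewrite mulrC ler_wpM2l// (le_trans (ler_norm C))// lerDl.
split; first by apply/cvg_ex; exists l.
exact: cvg_lim pl.
Unshelve. all: by end_near. Qed.

(** The square of the positive part of [t], which is C^1 but not C^2. *)
Definition ramp2 (t : R) : R := t * Num.max t 0.

Lemma ramp2_affine_derive (a b t : R) :
  is_derive t 1 (fun s => ramp2 (a * s + b)) (2 * a * Num.max (a * t + b) 0).
Proof.
apply: (@is_derive_quadratic _ _ _ (a ^+ 2)) => h; rewrite /ramp2 ler_norml.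
have -> : a * (h + t) + b = a * h + (a * t + b) by ring.
set y := a * t + b; set x := a * h.
have -> : a ^+ 2 * h ^+ 2 = x ^+ 2 by rewrite /x; ring.
have -> : h * (2 * a * Num.max y 0) = 2 * x * Num.max y 0 by rewrite /x; ring.
by case: (leP y 0) => y0; case: (leP (x + y) 0) => xy0; apply/andP; split; nra.
Qed.

(** Along the direction [i] the function is a translate of [p]; along any other it is constant. *)
Lemma C1_coord n (i : 'I_n) (p dp : R -> R) : (forall t : R, is_derive t 1 p (dp t)) ->
  continuous dp -> C1 setT (fun x : 'rV[R]_n => p (x ord0 i)).
Proof.
move=> pdp cdp j x _; have [->|ji] := eqVneq j i.
  have E (y : 'rV[R]_n) h : p (h *: (1 : R^o) + y ord0 i) =
      (fun x : 'rV[R]_n => p (x ord0 i)) (h *: delta_mx ord0 i + y).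
    by rewrite !mxE !eqxx mulr1 scaler1.
  split; first by apply: derivable_transport (E x) _; have [] := pdp (x ord0 i).
  have -> : partial i (fun x : 'rV[R]_n => p (x ord0 i)) = fun y => dp (y ord0 i).
    apply/funext => y; rewrite /partial -(derive_transport (E y)).
    by have [] := pdp (y ord0 i).
  apply: (@continuous_comp _ _ _ (fun y : 'rV[R]_n => y ord0 i) dp); last exact: cdp.
  exact: coord_continuous.
have E (y : 'rV[R]_n) h : cst (p (y ord0 i)) (h *: (1 : R^o) + 0) =
    (fun x : 'rV[R]_n => p (x ord0 i)) (h *: delta_mx ord0 j + y).
  by rewrite !mxE eqxx/= eq_sym (negbTE ji) mulr0 add0r.
split; first by apply: derivable_transport (E x) _; exact: derivable_cst.
have -> : partial j (fun x : 'rV[R]_n => p (x ord0 i)) = fun y => 0.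
  by apply/funext => y; rewrite /partial -(derive_transport (E y)) derive_cst.
exact: cst_continuous.
Qed.

Lemma C1_ramp2 n (i : 'I_n) (a b : R) :
  C1 setT (fun x : 'rV[R]_n => ramp2 (a * x ord0 i + b)).
Proof.
apply: (@C1_coord n i (fun t => ramp2 (a * t + b))
    (fun t => 2 * a * Num.max (a * t + b) 0)) => t; first exact: ramp2_affine_derive.
apply: (@continuousM _ _ (fun=> 2 * a) (fun t => Num.max (a * t + b) 0)).
  exact: cst_continuous.
apply: (@continuous_comp _ _ _ (fun t => a * t + b) (fun u => Num.max u 0)).
  apply: (@continuousD _ _ _ (fun t => a * t) (fun=> b)); last exact: cst_continuous.
  by apply: (@continuousM _ _ (fun=> a) id); [exact: cst_continuous|exact: cvg_id].
by apply: (@continuous_max _ _ id (fun=> 0)); [exact: cvg_id|exact: cst_continuous].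
Qed.

(** The C^1 quadratic spline equal to [2 * t ^+ 2] on [[0, 1/2]] and to [1 - 2 * (1 - t) ^+ 2] on
    [[1/2, 1]], constant elsewhere. *)
Definition smoothstep (t : R) : R :=
  2 * ramp2 t + (- 4 * ramp2 (t - 2^-1) + 2 * ramp2 (t - 1)).

Lemma smoothstep_le0 t : t <= 0 -> smoothstep t = 0.
Proof.
move=> t0; rewrite /smoothstep /ramp2 !max_r; lra.
Qed.

Lemma smoothstep_ge1 t : 1 <= t -> smoothstep t = 1.
Proof.
move=> t1; rewrite /smoothstep /ramp2 !max_l; lra.
Qed.

Lemma smoothstep_itv t : 0 <= smoothstep t <= 1.
Proof.
have [t0|t0] := leP t 0; first by rewrite smoothstep_le0// lexx ler01.
have [t1|t1] := leP 1 t; first by rewrite smoothstep_ge1// lexx ler01.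
rewrite /smoothstep /ramp2 (max_l (ltW t0)) (max_r (_ : t - 1 <= 0)); last lra.
by case: (leP (t - 2^-1) 0) => th; apply/andP; split; nra.
Qed.

(** A difference, so that sums of integer translates telescope. It vanishes outside [[0, 2]], an
    interval centred at 1. *)
Definition bump (t : R) : R := smoothstep t - smoothstep (t - 1).

Lemma bump_ge0 t : 0 <= bump t.
Proof.
rewrite subr_ge0; have [/andP[s0 _] /andP[_ s1]] := (smoothstep_itv t, smoothstep_itv (t - 1)).
have [t1|t1] := leP 1 t; first by rewrite (smoothstep_ge1 t1).
by rewrite (@smoothstep_le0 (t - 1))//; lra.
Qed.

Lemma bump_neq0 t : bump t != 0 -> `|1 - t| <= 1.
Proof.
move=> b0; rewrite ler_norml; apply/andP; split; apply: contraNT b0; rewrite -ltNge => ht.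
- by rewrite /bump !smoothstep_ge1 ?subrr//; lra.
- by rewrite /bump !smoothstep_le0 ?subrr//; lra.
Qed.

Lemma sum_bump N t : \sum_(m < N) bump (t - m%:R) = smoothstep t - smoothstep (t - N%:R).
Proof.
elim: N => [|N IHN]; first by rewrite big_ord0 subr0 subrr.
rewrite big_ord_recr /= IHN /bump.
by rewrite (_ : t - N.+1%:R = t - N%:R - 1); [ring|rewrite -natr1; ring].
Qed.

Lemma C1_bump n (i : 'I_n) (a b : R) :
  C1 setT (fun x : 'rV[R]_n => bump (a * x ord0 i + b)).
Proof.
have oT : open [set: 'rV[R]_n] by exact: openT.
have C1Z (c : R) (F : 'rV[R]_n -> R) : C1 setT F -> C1 setT (fun x => c * F x).
  by move=> dF; apply: (C1M oT _ dF); exact: C1_cst.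
have s1 b' : C1 setT (fun x : 'rV[R]_n => smoothstep (a * x ord0 i + b')).
  apply: C1D => //; first by apply: C1Z; exact: C1_ramp2.
  apply: C1D => //; apply: C1Z.
    by under eq_fun do rewrite -addrA; exact: C1_ramp2.
  by under eq_fun do rewrite -addrA; exact: C1_ramp2.
apply: (C1D oT (s1 b)).
apply: (C1_eq_in oT _ (C1Z (- 1) _ (s1 (b - 1)))) => x _.
by rewrite mulN1r addrA.
Qed.

(** Products over the coordinates of bumps rescaled by [k.+1%:R]. By distributivity their sum is the
    product of one-dimensional sums, each equal to 1 on the cube. *)
Lemma partition_of_unity n (M : nat) (e : R) : 0 < e ->
  exists (I : finType) (Psi : I -> 'rV[R]_n -> R) (c : I -> 'rV[R]_n),
  [/\ forall z, C1 setT (Psi z),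
      forall z x, 0 <= Psi z x,
      forall z x, Psi z x != 0 -> `|c z - x| <= e &
      forall x, `|x| <= M%:R -> \sum_z Psi z x = 1].
Proof.
move=> e0; have [k _ /(_ k (leqnn k))/= ke] := near_infty_natSinv_lt (PosNum e0).
(* For a coordinate in [[- M, M]], the argument of [smoothstep] after telescoping lies between 1 and
   [N]: its value there is 1, and 0 after the shift by [N]. *)
pose N := (2 * k.+1 * M + 1)%N.
have k0 : 0 < k.+1%:R :> R by [].
pose b (m : 'I_N) : R := (k.+1%:R * M%:R + 1) - m%:R.
exists {ffun 'I_n -> 'I_N}.
exists (fun (z : {ffun 'I_n -> 'I_N}) x => \prod_(i < n) bump (k.+1%:R * x ord0 i + b (z i))).
(* The point where every bump of the product has argument 1, the middle of its support. *)
exists (fun z : {ffun 'I_n -> 'I_N} => \row_i ((z i)%:R / k.+1%:R - M%:R)).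
split.
- by move=> z; apply: C1_prod => [|i]; [exact: openT|exact: C1_bump].
- by move=> z x; apply: prodr_ge0 => i _; exact: bump_ge0.
- move=> z x /prodf_neq0 zx; rewrite [leLHS]mx_normrE; apply: bigmax_le => [|[j i] _ /=].
    exact: ltW.
  rewrite (ord1 j) !mxE; have := bump_neq0 (zx i isT).
  have -> : 1 - (k.+1%:R * x ord0 i + b (z i)) =
      k.+1%:R * ((z i)%:R / k.+1%:R - M%:R - x ord0 i).
    by rewrite /b; field.
  rewrite normrM gtr0_norm// mulrC -ler_pdivlMr// mul1r => /le_trans; apply.
  exact: ltW.
- move=> x xM; rewrite -(bigA_distr_bigA (fun i m => bump (k.+1%:R * x ord0 i + b m))).
  rewrite big1// => i _.
  rewrite (eq_bigr (fun m : 'I_N => bump (k.+1%:R * (x ord0 i + M%:R) + 1 - m%:R))).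
    have := le_trans (coord_le_norm x i) xM; rewrite ler_norml => /andP[xl xu].
    rewrite sum_bump smoothstep_ge1 ?smoothstep_le0 ?subr0//.
      rewrite /N natrD !natrM; nra.
    by rewrite lerDr mulr_ge0//; lra.
  by move=> m _; congr bump; rewrite /b; ring.
Qed.

End partition_of_unity.

(** * Unit directions *)

Section direction.
Context {R : realType} {n : nat}.
Implicit Types u : 'rV[R]_n.

(* [direction 0 = 0], by the convention [0^-1 = 0]. *)
Definition direction u : 'rV[R]_n := (enorm u)^-1 *: u.

Lemma enorm_direction u : enorm (direction u) <= 1.
Proof.
rewrite enormZ ger0_norm ?invr_ge0 ?enorm_ge0//.
have [->|u0] := eqVneq (enorm u) 0; first by rewrite mulr0.
by rewrite mulVf.
Qed.

Lemma dot_direction u : dot (direction u) u = enorm u.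
Proof.
rewrite dotZl dot_sq; have [->|u0] := eqVneq (enorm u) 0.
  by rewrite expr0n mulr0.
by rewrite expr2 mulrA mulVf// mul1r.
Qed.

End direction.

(** * Admissible fields built from a partition of unity *)

Section smooth_approximation.
Context {R : realType} {n : nat}.
Variables (D : set 'rV[R]_n) (v : 'rV[R]_n -> 'rV[R]_n) (W : 'rV[R]_n -> R).
Hypothesis W0 : forall x, 0 <= W x.

(** In the last clause, every [z] with [Psi z x != 0] has its ball inside [closed_ball x (2 * e)].
    Hence [z] is good, its weight is at least [a], its scalar product with [v x] is at least [b],
    and averaging with the weights [Psi z x] gives [a * b]. *)
Lemma smooth_field_below (M : nat) (e : R) : 0 < e -> open D ->
  (forall x, D x -> `|x| <= M%:R) ->
  exists phi : 'rV[R]_n -> 'rV[R]_n,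
  [/\ C1c D phi,
      forall x, D x -> enorm (phi x) <= W x,
      forall x, D x -> 0 <= dot (phi x) (v x) &
      forall x a b, 0 <= a -> 0 <= b -> closed_ball x (2 * e) `<=` D -> D x ->
        (forall y, closed_ball x (2 * e) y -> a <= W y) ->
        (forall y z, closed_ball x (2 * e) y -> closed_ball x (2 * e) z ->
          b <= dot (direction (v y)) (v z)) ->
        a * b <= dot (phi x) (v x)].
Proof.
move=> e0 oD DM; have [I [Psi [c [dPsi Psi0 Psic Psi1]]]] := partition_of_unity n M e0.
pose B z := closed_ball (c z) e.
have BE z x : B z x <-> `|c z - x| <= e by rewrite /B closed_ballE.
(* The first condition keeps the support of the field inside [D]; the second makes every term of the
   scalar product with [v] nonnegative. *)
pose good z := B z `<=` D /\ forall y, B z y -> 0 <= dot (direction (v (c z))) (v y).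
(* With an infimum as weight, [w z <= W] on the support of [Psi z], so the average of the weights at
   [x] is at most [W x]. *)
pose w z := if pselect (good z) then inf (W @` B z) else 0.
have infW z : has_inf (W @` B z).
  split; last by exists 0 => _ [y _ <-].
  by exists (W (c z)); exists (c z) => //; apply/BE; rewrite subrr normr0 ltW.
have w0 z : 0 <= w z.
  rewrite /w; case: pselect => /= [?|?] //; apply: lb_le_inf; first exact: (infW z).1.
  by move=> _ [y _ <-].
have wW z x : Psi z x != 0 -> w z <= W x.
  move=> /Psic/BE Bx; rewrite /w; case: pselect => /= [?|?] //.
  by apply: ge_inf; [exact: (infW z).2|exists x].
pose phi x := \sum_z (Psi z x * w z) *: direction (v (c z)).
have phiv x : dot (phi x) (v x) = \sum_z (Psi z x * w z) * dot (direction (v (c z))) (v x).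
  by rewrite /phi dot_suml; apply: eq_bigr => z _; rewrite dotZl.
have Pw0 z x : 0 <= Psi z x * w z by rewrite mulr_ge0.
have term0 z x : 0 <= (Psi z x * w z) * dot (direction (v (c z))) (v x).
  have [->|/Psic/BE Bx] := eqVneq (Psi z x) 0; first by rewrite !mul0r.
  rewrite /w; case: pselect => /= [gz|_]; last by rewrite mulr0 mul0r.
  by apply: mulr_ge0; [apply: mulr_ge0 => //; apply: lb_le_inf (infW z).1 _ => _ [y _ <-]|exact: gz.2].
(* A finite union of closed balls contained in [D]: it is compact and contains every point where
   [phi] is nonzero. *)
pose K := \big[setU/set0]_(z <- enum I | `[< good z >]) B z.
have cK : compact K.
  apply: bigsetU_compact => z _; apply: bounded_closed_compact; last first.
    exact: closed_ball_closed.
  exists (`|c z| + e); split; first exact: num_real.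
  move=> t et x /BE cx /=; apply: le_trans (ltW et).
  rewrite -[x](subrK (c z)) addrC (le_trans (ler_normD _ _))// lerD2l distrC//.
have clK : closed K by apply: compact_closed => //; exact: norm_hausdorff.
have KP x : K x <-> exists z, good z /\ B z x.
  rewrite /K -bigcup_seq_cond; split=> [[z /andP[_ /asboolP gz] Bx]|[z [gz Bx]]].
    by exists z.
  by exists z => //=; rewrite mem_enum; apply/asboolP.
have supp x : phi x != 0 -> K x.
  move=> phix; apply/KP; apply: contrapT => /forallNP Nx; move/eqP: phix; apply.
  apply: big1 => z _; have [->|/Psic/BE Bx] := eqVneq (Psi z x) 0.
    by rewrite mul0r scale0r.
  rewrite /w; case: pselect => /= [gz|_]; last by rewrite mulr0 scale0r.
  by case: (Nx z).
exists phi; split.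
- split=> [i|].
    have oT : open [set: 'rV[R]_n] by exact: openT.
    suff : C1 setT (fun x => phi x ord0 i) by move=> h j x _; exact: h.
    have -> : (fun x => phi x ord0 i) =
        (fun x => \sum_z Psi z x * (w z * direction (v (c z)) ord0 i)).
      apply/funext => x; rewrite /phi summxE; apply: eq_bigr => z _.
      by rewrite mxE mulrA.
    by apply: (C1_sum _ oT) => z; apply: (C1M oT (dPsi z)); exact: C1_cst.
  have sK : closure [set x | D x /\ phi x != 0] `<=` K.
    apply: subset_trans (_ : closure K `<=` K); first by apply: closure_subset => x [_ /supp].
    by rewrite -(closure_id K).1.
  have -> : support_in D phi = closure [set x | D x /\ phi x != 0].
    by apply: setIidr => x /sK/KP[z [[zD _] /zD]].
  by apply: subclosed_compact sK => //; exact: closed_closure.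
- move=> x Dx; rewrite (le_trans (enorm_sum_le _ _ _))// => [z|]; first exact: enorm_direction.
  rewrite -[leRHS]mul1r -(Psi1 x (DM x Dx)) mulr_suml; apply: ler_sum => z _.
  have [->|Pz] := eqVneq (Psi z x) 0; first by rewrite !mul0r.
  by rewrite ler_wpM2l// wW.
- by move=> x Dx; rewrite phiv; apply: sumr_ge0.
- move=> x a b a0 b0 xD Dx aW bv.
  rewrite phiv -[leLHS]mul1r -(Psi1 x (DM x Dx)) mulr_suml; apply: ler_sum => z _.
  have [->|Pz] := eqVneq (Psi z x) 0; first by rewrite !mul0r.
  have Bx : B z `<=` closed_ball x (2 * e).
    move=> y /BE cy; rewrite closed_ballE ?mulr_gt0//= /closed_ball_/=.
    rewrite -(subrK (c z) x) -addrA (le_trans (ler_normD _ _))// [2 * e](_ : _ = e + e).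
      by rewrite lerD// distrC; exact: Psic.
    by rewrite mulr_natl mulr2n.
  have Bc : B z (c z) by apply/BE; rewrite subrr normr0 ltW.
  (* The sign condition of [good] comes from [0 <= b]. *)
  have gz : good z.
    split=> [y /Bx/xD//|y By].
    by apply: (le_trans b0); apply: bv; apply: Bx.
  rewrite -mulrA ler_wpM2l//; apply: ler_pM => //.
    rewrite /w; case: pselect => /= [?|?] //; apply: lb_le_inf; first exact: (infW z).1.
    by move=> _ [y By <-]; apply: aW; apply: Bx.
  apply: bv; apply: Bx => //.
  by apply/BE; exact: Psic.
Qed.

End smooth_approximation.

(** * Pointwise convergence of the approximating fields *)

Section smooth_approximation_limit.
Context {R : realType} {n : nat}.
Variables (D : set 'rV[R]_n) (v : 'rV[R]_n -> 'rV[R]_n) (W : 'rV[R]_n -> R).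
Hypothesis W0 : forall x, 0 <= W x.
Hypothesis oD : open D.
Hypothesis cv : forall i x, D x -> {for x, continuous (fun y => v y ord0 i)}.

Lemma near_enormB (x : 'rV[R]_n) (e : R) : D x -> 0 < e ->
  \forall y \near x, enorm (v y - v x) < e.
Proof.
move=> Dx e0; pose F y := \sum_(i < n) (v y ord0 i - v x ord0 i) * (v y ord0 i - v x ord0 i).
have FE y : enorm (v y - v x) = Num.sqrt (F y).
  by congr Num.sqrt; apply: eq_bigr => i _; rewrite !mxE expr2.
have cF : {for x, continuous F}.
  apply: continuous_sum => i.
  have ci : {for x, continuous (fun y => v y ord0 i - v x ord0 i)}.
    by apply: continuousB; [exact: cv|exact: cst_continuous].
  by apply: continuousM; exact: ci.
have csF : {for x, continuous (fun y => Num.sqrt (F y))}.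
  by apply: (@continuous_comp _ _ _ F Num.sqrt); [exact: cF|exact: sqrt_continuous].
have F0 : Num.sqrt (F x) < e by rewrite -FE subrr enorm0.
have := @cvgr_lt R _ _ (nbhs_filter x) _ _ csF _ F0.
by apply: filterS => y; rewrite FE.
Qed.

(** Writing [v z] as [v y] plus an error reduces the claim to [dot_direction] at [y], so that only
    the continuity of [v] is used and not that of its direction. *)
Lemma near_dot_direction (x : 'rV[R]_n) (b : R) : D x -> b < enorm (v x) ->
  \forall y \near x & z \near x, b <= dot (direction (v y)) (v z).
Proof.
(* Three errors below [e] add up: one from [v z - v x], one from [v y - v x], and one from comparing
   [enorm (v y)] with [enorm (v x)]. *)
move=> Dx bx; pose e := (enorm (v x) - b) / 3.
have e0 : 0 < e by rewrite divr_gt0// subr_gt0.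
have near_e := near_enormB Dx e0.
exists ([set y | enorm (v y - v x) < e], [set y | enorm (v y - v x) < e]) => //=.
move=> [y z] [/= ye ze].
have -> : v z = v y + ((v z - v x) - (v y - v x)).
  by apply/rowP => i; rewrite !mxE; ring.
rewrite dotDr dot_direction.
have dle : - dot (direction (v y)) (v z - v x - (v y - v x)) <=
    enorm (v z - v x) + enorm (v y - v x).
  rewrite -dotNl (le_trans (dot_le _ _))// enormN.
  rewrite (le_trans (ler_wpM2r (enorm_ge0 _) (enorm_direction _)))// mul1r.
  by rewrite (le_trans (enormD _ _))// enormN.
have vyx : enorm (v x) <= enorm (v y) + enorm (v y - v x).
  by rewrite -{1}(subKr (v y) (v x)) (le_trans (enormD _ _))// enormN.
have e3 : 3 * e = enorm (v x) - b by rewrite /e mulrC divfK.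
lra.
Qed.

(** The fields of [smooth_field_below] at mesh [k.+1%:R^-1]. Cauchy-Schwarz bounds the scalar
    products above by the limit; below, any smaller positive number is a product [a * b] with
    [a < W x] and [b < enorm (v x)], bounds that persist near [x]. *)
Lemma smooth_fields_cvg : bounded_set D ->
  exists phi : nat -> 'rV[R]_n -> 'rV[R]_n,
  [/\ forall k, C1c D (phi k),
      forall k x, D x -> enorm (phi k x) <= W x,
      forall k x, D x -> 0 <= dot (phi k x) (v x) &
      forall x, D x -> lower_semicontinuous_at W x ->
        dot (phi k x) (v x) @[k --> \oo] --> W x * enorm (v x)].
Proof.
move=> [B [_ /(_ (`|B| + 1))BD]].
have {}BD : forall x, D x -> `|x| <= `|B| + 1.
  by apply: BD; rewrite (le_lt_trans (ler_norm B))// ltrDl.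
have DM x : D x -> `|x| <= (Num.trunc (`|B| + 1)).+1%:R.
  by move=> /BD xB; rewrite (le_trans xB)// ltW// truncnS_gt.
have k0 (k : nat) : 0 < k.+1%:R^-1 :> R by rewrite invr_gt0.
have [phi Hphi] := choice (fun k => smooth_field_below v W0 (k0 k) oD DM).
exists phi; split.
- by move=> k; have [] := Hphi k.
- by move=> k; have [] := Hphi k.
- by move=> k; have [] := Hphi k.
move=> x Dx lscx; apply/cvgrPdist_le => e e0.
have phi_ge0 k : 0 <= dot (phi k x) (v x) by have [_ _ /(_ x Dx)] := Hphi k.
have phi_le k : dot (phi k x) (v x) <= W x * enorm (v x).
  rewrite (le_trans (dot_le _ _))// ler_wpM2r ?enorm_ge0//.
  by have [_ /(_ x Dx)] := Hphi k.
set L := W x * enorm (v x).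
suff : \forall k \near \oo, L - e <= dot (phi k x) (v x).
  apply: filterS => k Lk; rewrite ger0_norm ?subr_ge0 ?phi_le//.
  by rewrite lerBlDr addrC -lerBlDr.
(* If [L - e <= 0], nonnegativity of the scalar products suffices. Otherwise [W x] and [enorm (v x)]
   are both positive and can be divided by. *)
have [Le|Le] := leP (L - e) 0.
  by apply: nearW => k; rewrite (le_trans Le).
have L0 : 0 < L by rewrite (lt_trans Le)// gtrBl.
have Wx0 : 0 < W x.
  by rewrite lt_def W0 andbT; apply: contraTneq L0; rewrite /L => ->; rewrite mul0r ltxx.
have vx0 : 0 < enorm (v x).
  rewrite lt_def enorm_ge0 andbT; apply: contraTneq L0; rewrite /L => ->.
  by rewrite mulr0 ltxx.
have : (L - e) / W x < enorm (v x).
  by rewrite ltr_pdivrMr// mulrC -/L gtrBl.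
(* [b] lies strictly between [(L - e) / W x] and [enorm (v x)]; the first inequality is what makes
   [a = (L - e) / b] smaller than [W x]. *)
move=> /midf_lt; set b := (_ + _) / 2 => -[Lb bv].
have b0 : 0 < b by rewrite (lt_trans _ Lb)// divr_gt0.
pose a := (L - e) / b.
have aW : a < W x by rewrite /a ltr_pdivrMr// mulrC -ltr_pdivrMr.
have a0 : 0 <= a by rewrite divr_ge0// ltW.
have [[A1 A2] /= [nA1 nA2] A12] := near_dot_direction Dx bv.
have : nbhs x (D `&` [set y | a < W y] `&` (A1 `&` A2)).
  by apply: filterI; apply: filterI => //; [exact: open_nbhs_nbhs|exact: lscx].
move=> /nbhs_closedballP[r rD].
(* The radius is halved because [smooth_field_below] looks at balls of twice the mesh. *)
have r0 : 0 < r%:num / 2 by [].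
have [m _ mr] := near_infty_natSinv_lt (PosNum r0).
exists m => // k /= /mr /= kr.
have kD : closed_ball x (2 * k.+1%:R^-1) `<=`
    D `&` [set y | a < W y] `&` (A1 `&` A2).
  apply: subset_trans rD; apply: le_closed_ball.
  by rewrite mulrC -ler_pdivlMr// ltW.
have -> : L - e = a * b by rewrite /a divfK// gt_eqF.
have [_ _ _ phik] := Hphi k; apply: phik => //; first exact: ltW.
- by move=> y /kD[[]].
- by move=> y /kD[[_ /ltW]].
- by move=> y z /kD[_ [A1y _]] /kD[_ [_ A2z]]; exact: (A12 (y, z)).
Qed.

End smooth_approximation_limit.

(** * The variational formula for a general weight *)

Section variational_formula.
Context {R : realType} {n : nat}.
Implicit Types (D : set 'rV[R]_n) (g f W : 'rV[R]_n -> R).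

Lemma lower_semicontinuous_powR f (p : R) x : (forall y, 0 <= f y) -> 0 <= p ->
  (0 < p -> lower_semicontinuous_at f x) ->
  lower_semicontinuous_at (fun y => f y `^ p) x.
Proof.
move=> f0; rewrite le_eqVlt => /predU1P[<- _|p0 /(_ p0) fx] a afx.
  by apply: (@filterE _ (nbhs x) (nbhs_filter x)) => y; rewrite /= powRr0 -(powRr0 (f x)).
have [a0|a0] := ltP a 0; first by apply: (@filterE _ (nbhs x) (nbhs_filter x)) => y; rewrite (lt_le_trans a0)// powR_ge0.
have aE : a = (a `^ p^-1) `^ p by rewrite -powRrM mulVf ?gt_eqF// powRr1.
have : a `^ p^-1 < f x.
  rewrite ltNge; apply: contraTN afx => fa; rewrite -leNgt aE.
  by apply: (ge0_ler_powR (ltW p0)); rewrite ?nnegrE ?powR_ge0.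
move=> /fx; apply: filterS => y fy; rewrite aE.
by apply: (gt0_ltr_powR p0); rewrite ?nnegrE ?powR_ge0.
Qed.

Lemma gradient_coord_continuous D g : C1 D g -> forall i x, D x ->
  {for x, continuous (fun y => gradient g y ord0 i)}.
Proof.
move=> dg i x Dx; apply: continuous_near_eq (dg i x Dx).2.
by apply: (@filterE _ (nbhs x) (nbhs_filter x)) => y; rewrite mxE.
Qed.

Lemma measurable_dot_gradient D g phi : open D -> C1 D g -> C1c D phi ->
  measurable_fun D (fun x => dot (gradient g x) (phi x)).
Proof.
move=> oD dg [dphi _]; apply: continuous_measurable_rV => // x Dx.
apply: continuous_sum => i; apply: continuousM.
  exact: (gradient_coord_continuous dg Dx).
exact: C1_continuous oD (dphi i) _ Dx.
Qed.

Lemma measurable_enorm_gradient D g : open D -> C1 D g ->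
  measurable_fun D (fun x => enorm (gradient g x)).
Proof.
move=> oD dg; apply: continuous_measurable_rV => // x Dx.
apply: (@continuous_comp _ _ _ (fun y => \sum_(i < n) gradient g y ord0 i ^+ 2) Num.sqrt).
  apply: continuous_sum => i.
  have cgi := @gradient_coord_continuous D g dg i x Dx.
  by apply: continuousM; exact: cgi.
exact: sqrt_continuous.
Qed.

Lemma ereal_sup_divergence D g W : open D -> bounded_set D -> C1 D g ->
  measurable_fun D W -> (forall x, 0 <= W x) ->
  {ae lebesgue_rV R n, forall x, D x -> lower_semicontinuous_at W x} ->
  ereal_sup [set (\int[lebesgue_rV R n]_(x in D) (g x * divergence phi x)%:E)%E
    | phi in [set phi | C1c D phi /\ forall x, D x -> enorm (phi x) <= W x]] =
  (\int[lebesgue_rV R n]_(x in D) (enorm (gradient g x) * W x)%:E)%E.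
Proof.
move=> oD bD dg mW W0 [N [mN N0 lscN]]; set S := [set _ | _ in _].
have mD := open_measurable_rV oD.
have mgW : measurable_fun D (fun x => (enorm (gradient g x) * W x)%:E).
  by apply/measurable_EFinP; apply: measurable_funM => //; exact: measurable_enorm_gradient.
have gW0 x : (0 <= (enorm (gradient g x) * W x)%:E)%E.
  by rewrite lee_fin mulr_ge0 ?enorm_ge0.
apply/eqP; rewrite eq_le; apply/andP; split.
  apply: ub_ereal_sup => _ [phi [dphi phiW] <-]; rewrite divergence_by_parts//.
  have mdot := measurable_dot_gradient oD dg dphi.
  have mNdot : measurable_fun D (fun x => (- dot (gradient g x) (phi x))%:E).
    by apply/measurable_EFinP; exact: measurableT_comp.
  (* Absolute values make both integrands nonnegative, so that monotonicity applies even when the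
     right-hand integral is infinite. *)
  apply: (le_trans (lee_abs _)); apply: (le_trans (le_abse_integral _ mD mNdot)).
  apply: ge0_le_integral => //; first exact: measurableT_comp.
  move=> x Dx; rewrite lee_fin normrN ler_norml.
  have ler_gW : enorm (gradient g x) * enorm (phi x) <= enorm (gradient g x) * W x.
    by rewrite ler_wpM2l ?enorm_ge0// phiW.
  rewrite lerNl -dotNl !(le_trans _ ler_gW) ?dot_le//.
  by rewrite (le_trans (dot_le _ _))// enormN.
(* The field to approximate is minus the gradient, the sign coming from [divergence_by_parts]. *)
have cv i x : D x -> {for x, continuous (fun y => (- gradient g y) ord0 i)}.
  move=> Dx; apply: (@continuous_near_eq _ _ _ (fun y => - gradient g y ord0 i)).
    by apply: (@filterE _ (nbhs x) (nbhs_filter x)) => y; rewrite mxE.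
  by apply: continuousN; exact: (gradient_coord_continuous dg Dx).
have [phi [dphi phiW phi0 phi_cvg]] := smooth_fields_cvg W0 oD cv bD.
pose F k x := (dot (phi k x) (- gradient g x))%:E.
have FE k x : F k x = (- dot (gradient g x) (phi k x))%:E by rewrite /F dotC dotNl.
have mF k : measurable_fun D (F k).
  rewrite (funext (FE k)); apply/measurable_EFinP; apply: measurableT_comp => //.
  exact: measurable_dot_gradient.
have mDN : measurable (D `\` N) by exact: measurableD.
have DND : D `\` N `<=` D by exact: subDsetl.
(* Off the null set [N] the weight is lower semicontinuous at every point of [D], and the integrand
   is the limit of the [F k]. *)
rewrite (ge0_negligible_integral mN)//.
have -> : (\int[lebesgue_rV R n]_(x in D `\` N) (enorm (gradient g x) * W x)%:E =
    \int[lebesgue_rV R n]_(x in D `\` N) limn_einf (F ^~ x))%E.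
  apply: eq_integral => x /set_mem[Dx Nx]; apply/esym.
  apply: (cvg_limn_einf_sup _).1; apply: cvg_EFin; first exact: nearW.
  rewrite mulrC -enormN; apply: phi_cvg => //.
  by apply: contrapT => lx; apply: Nx; apply: lscN => /= /(_ Dx).
apply: le_trans (fatou _ _ _ _) _ => //.
- by move=> k; exact: measurable_funS (mF k).
- by move=> k x [Dx _]; rewrite lee_fin phi0.
(* The limit inferior is a limit of infima over tails; the infimum from [k] on is at most the [k]-th
   integral, hence at most the supremum. *)
rewrite limn_einf_lim; apply: lime_le; first exact: is_cvg_einfs.
apply: nearW => k; apply: (@le_trans _ _ (\int[lebesgue_rV R n]_(x in D `\` N) F k x)%E).
  by apply: ereal_inf_lbound; exists k => /=.
apply: (@le_trans _ _ (\int[lebesgue_rV R n]_(x in D) F k x)%E).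
  by apply: ge0_subset_integral => // x Dx; rewrite lee_fin phi0.
apply: ereal_sup_ubound; exists (phi k); first by split => //; exact: phiW.
by rewrite divergence_by_parts//; apply: eq_integral => x _; rewrite FE.
Qed.

End variational_formula.

Unset Implicit Arguments.

Theorem theorem4p6 (R : realType) (n : nat) (disp : measure_display)
    (T : measurableType disp) (P : probability T R)
    (Omega : set 'rV[R]_n) (X : {RV P >-> 'rV[R]_n}) (f : 'rV[R]_n -> R)
    (g : 'rV[R]_n -> R) (Y : T -> R) (d : R)
    (Omega_open : open Omega)
    (Omega_bounded : bounded_set Omega)
    (X_in_Omega : forall t, Omega (X t))
    (X_density : has_density X f)
    (g_C1 : C1_closure Omega g)
    (Y_def : forall t, Y t = g (X t))
    (d_ge0 : 0 <= d)
    (f_lsc : 0 < d -> {ae lebesgue_rV R n, forall x : 'rV[R]_n,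
        Omega x -> lower_semicontinuous_at f x}) :
  PEACE Omega f g d =
  (\int[lebesgue_rV R n]_(x in Omega)
     (enorm (gradient g x) * f x `^ (2 * d))%:E)%E.
Proof.
have [mf f0 _] := X_density; have [_ dg _] := g_C1.
apply: ereal_sup_divergence => //.
- apply: measurable_funTS.
  exact: (measurableT_comp (measurable_powR (2 * d)) mf).
- by move=> x; exact: powR_ge0.
(* For [d = 0] the weight is the constant 1, which is lower semicontinuous; for [0 < d] the
   regularity comes from [f_lsc]. *)
have [d0|d0] := leP d 0.
  have d20 : 2 * d = 0 by rewrite (le_anti (introT andP (conj d0 d_ge0))) mulr0.
  apply: nearW => x _; apply: lower_semicontinuous_powR => //; rewrite d20//.
  by rewrite ltxx.
apply: filterS (f_lsc d0) => x fx /fx lx.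
by apply: lower_semicontinuous_powR => //; rewrite mulr_ge0.
Qed.
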